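(* Let $q$ be a prime power and let $n>1$ be an integer. Then the semilinear group $\Gamma(q^n)$ is IBIS if and only if $n$ is a prime.
   Context: $\Gamma(q^n)=\{x\mapsto ax^{\sigma}\mid a\in \mathrm{GF}(q^n)^*,\ \sigma\in \mathrm{Gal}(\mathrm{GF}(q^n)/\mathrm{GF}(q))\}$, acting on $V=\mathrm{GF}(q^n)$, an $n$-dimensional vector space over $\mathrm{GF}(q)$. For a finite permutation group $G$ on $\Omega$, a sequence $(\omega_1,\dots,\omega_t)$ is an irredundant base if its pointwise stabilizer is trivial and no $\omega_i$ is fixed by the pointwise stabilizer of its predecessors. $G$ is IBIS if all its irredundant bases have the same cardinality. A linear group on $V$ is called IBIS if it induces an IBIS permutation group on $V\setminus\{0\}$. *)

(* Defs.v *)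
From HB Require Import structures.
From mathcomp Require Import all_boot all_order all_algebra.
From mathcomp Require Import all_fingroup all_solvable all_field.

Set Implicit Arguments.
Unset Strict Implicit.
Unset Printing Implicit Defensive.

Import GRing.Theory.

Definition prime_power (q : nat) : Prop :=
  exists p k : nat, [/\ prime p, (0 < k)%N & q = (p ^ k)%N].

Definition pointwise_stabilizer (T : finType) (G : {group {perm T}})
    (s : seq T) : {set {perm T}} :=
  'C_G([set x in s] | 'P)%g.

(* The first point of s has no predecessors: pointwise_stabilizer G [::] = G, *)
(* so G itself must move it.                                                  *)
Definition irredundant_base (T : finType) (G : {group {perm T}})
    (s : seq T) : bool :=
  (pointwise_stabilizer G s == 1%g) &&
  [forall i : 'I_(size s),
     tnth (in_tuple s) i \notin 'Fix_('P)(pointwise_stabilizer G (take i s))%g].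

Definition IBIS (T : finType) (G : {group {perm T}}) : Prop :=
  forall s t : seq T,
    irredundant_base G s -> irredundant_base G t -> size s = size t.

Local Open Scope ring_scope.

(* finvect_type V is V itself, seen as a finite type.  Being permutations,    *)
(* the elements of a linear group are automatically invertible.               *)
Record linear_group (F : finFieldType) (V : vectType F) := LinearGroup {
  linear_group_val :> {group {perm (finvect_type V)}};
  linear_groupP : forall g : {perm (finvect_type V)}, g \in linear_group_val ->
    linear (g : finvect_type V -> finvect_type V)
}.

Definition nonzero_vector (F : finFieldType) (V : vectType F) : finType :=
  {x : finvect_type V | x != 0}.

(* The image of G in the symmetric group of V \ {0}; every element of a       *)
(* linear group fixes 0, hence lies in the domain of 'P^? (cf the lemma       *)
(* below).                                                                    *)
Definition induced_on_nonzero (F : finFieldType) (V : vectType F)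
    (G : linear_group V) : {group {perm (nonzero_vector V)}} :=
  [group of (actperm ('P^? : action _ (nonzero_vector V)) @* G)%g].

Lemma linear_group_subact_dom (F : finFieldType) (V : vectType F)
    (G : linear_group V) :
  G \subset subact_dom (fun x : finvect_type V => x != 0) 'P%act.
Proof.
apply/subsetP=> g /linear_groupP lin_g; rewrite !inE /=.
apply/subsetP=> x; rewrite !inE /= apermE; apply: contraNneq => gx0.
have := lin_g 1 0 0; rewrite scaler0 addr0 scale1r -{1}[g 0]addr0.
by move/addrI => /esym g0; rewrite -(inj_eq (@perm_inj _ g)) gx0 g0.
Qed.

Definition linear_IBIS (F : finFieldType) (V : vectType F)
    (G : linear_group V) : Prop :=
  IBIS (induced_on_nonzero G).

(* The maps x |-> a * sigma x with a != 0 and sigma in Gal(L / F); here  *)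
(* the vector space 1 is the image of F in L.                                 *)
Definition Gamma_set (F : finFieldType) (L : fieldExtType F) :
    {set {perm (finvect_type L)}} :=
  [set g : {perm (finvect_type L)} |
    [exists a : finvect_type L,
     exists sigma : gal_of {:finvect_type L},
      [&& a != 0, sigma \in 'Gal({:finvect_type L} / 1)%g
        & [forall x : finvect_type L, g x == a * sigma x]]]].

Lemma Gamma_setP (F : finFieldType) (L : fieldExtType F)
    (g : {perm (finvect_type L)}) :
  reflect (exists a : finvect_type L, exists sigma : gal_of {:finvect_type L},
             [/\ a != 0, sigma \in 'Gal({:finvect_type L} / 1)%g
               & forall x : finvect_type L, g x = a * sigma x])
          (g \in Gamma_set L).
Proof.
rewrite inE; apply: (iffP existsP) => -[a].
  case/existsP=> s /and3P[a0 sG /forallP gE].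
  by exists a, s; split=> // x; apply/eqP.
case=> s [a0 sG gE]; exists a; apply/existsP; exists s.
by rewrite a0 sG; apply/forallP=> x; apply/eqP.
Qed.

Lemma Gamma_group_set (F : finFieldType) (L : fieldExtType F) :
  group_set (Gamma_set L).
Proof.
apply/group_setP; split.
  apply/Gamma_setP; exists 1, 1%g; split=> [||x]; rewrite ?oner_eq0 ?group1 //.
  by rewrite perm1 mul1r gal_id.
move=> g h /Gamma_setP[a [s [a0 sG gE]]] /Gamma_setP[b [t [b0 tG hE]]].
apply/Gamma_setP; exists (b * t a), (s * t)%g; split; rewrite ?groupM //.
  by rewrite mulf_neq0 ?fmorph_eq0.
by move=> x; rewrite permM gE hE rmorphM mulrA galM ?memvf.
Qed.

Definition Gamma_group (F : finFieldType) (L : fieldExtType F) :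
    {group {perm (finvect_type L)}} :=
  group (Gamma_group_set L).

Lemma Gamma_linear (F : finFieldType) (L : fieldExtType F)
    (g : {perm (finvect_type L)}) :
  g \in Gamma_group L -> linear (g : finvect_type L -> finvect_type L).
Proof.
case/Gamma_setP=> a [s [_ _ gE]] k x y.
by rewrite !gE linearP mulrDr scalerAr.
Qed.

Definition Gamma (F : finFieldType) (L : fieldExtType F) : linear_group L :=
  LinearGroup (@Gamma_linear F L).

(* Main.v *)
Require Import Defs.
From HB Require Import structures.
From mathcomp Require Import all_boot all_order all_algebra.
From mathcomp Require Import all_fingroup all_solvable all_field.

Import GRing.Theory.

(** Fix a point x of L \ {0}.  A map v |-> a * sigma v fixes x exactly when it
    is v |-> x * sigma (v / x), so the stabilizer of x is a copy of Gal(L / F),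
    and the stabilizer of x and of further points y_1, ..., y_k corresponds to
    the automorphisms fixing the ratios y_i / x, that is, to Gal(L / K) with
    K = F(y_1 / x, ..., y_k / x).  As L / F is Galois, a point z is fixed by
    this stabilizer if and only if z / x lies in K
    ([mem_fix_pointwise_stabilizer_cons]).  Hence the irredundant bases starting
    at x are the sequences whose ratios to x generate a strictly increasing
    chain of fields from F up to L ([irredundant_base_GammaP]).

    If n is prime there is no field strictly between F and L, so every such
    chain has one step and every irredundant base has two points.  If n is
    composite, Cauchy's theorem in Gal(L / F) and the Galois correspondence give
    a field E strictly between F and L.  Writing E = F(b) and L = F(a), both
    (1, a) and (1, b, a) are irredundant bases, of different sizes. *)

Set Implicit Arguments.
Unset Strict Implicit.
Unset Printing Implicit Defensive.

Local Open Scope ring_scope.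

Section FiniteFieldSubfields.

Variables (F : finFieldType) (L : splittingFieldType F).

(** Finite extensions of finite fields are separable, hence simple.  The
    generator is asked to be nonzero so that it can serve as a point of the
    permutation domain, even when E is the base field. *)
Lemma finField_primitive_element (E : {subfield L}) :
  exists2 a : L, a != 0 & <<1; a>>%VS = E :> {vspace L}.
Proof.
have s1E : (1 <= E)%VS by exact: sub1v.
have [_ sepE _] := and3P (finField_galois s1E).
have /esym genE := eq_adjoin_separable_generator sepE s1E.
set b := separable_generator _ _ in genE.
have [b0|b_neq0] := eqVneq b 0; last by exists b.
(* The generator 0 only generates the base field, which 1 generates too. *)
exists 1; rewrite ?oner_neq0 // -genE b0; apply/eqP; rewrite eqEsubv.
by apply/andP; split; apply/FadjoinP; rewrite subv_adjoin ?mem1v ?mem0v.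
Qed.

(** A subgroup of prime order p of the Galois group, p the least prime divisor
    of the composite degree n, has a fixed field of degree n / p. *)
Lemma finField_intermediate :
  (1 < \dim {:L})%N -> ~~ prime (\dim {:L}) ->
  exists E : {subfield L}, (1 < \dim E < \dim {:L})%N.
Proof.
set n := \dim _ => n_gt1 n_comp.
have n_gt0 : (0 < n)%N by exact: ltnW.
have cardG : #|'Gal({:L} / 1)%g| = n.
  by rewrite -galois_dim ?finField_galois ?sub1v //= dimv1 divn1.
have p_pr := pdiv_prime n_gt1.
have [|s _ os] := @Cauchy _ (pdiv n) 'Gal({:L} / 1)%G p_pr.
  by rewrite cardG pdiv_dvd.
exists (fixedField <[s]>%g)%AS.
have := dim_fixedField <[s]>%g; rewrite -orderE os -/n => pE.
have nE : n = (pdiv n * \dim (fixedField <[s]>%g))%N.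
  by rewrite {1}pE divnK // field_dimS // subvf.
have p_gt1 := prime_gt1 p_pr.
have d_gt0 : (0 < \dim (fixedField <[s]>%g))%N by exact: adim_gt0.
apply/andP; split; last by rewrite [ltnRHS]nE ltn_Pmull.
rewrite ltn_neqAle d_gt0 andbT; apply: contraNneq n_comp => d1.
by rewrite nE -d1 muln1.
Qed.

End FiniteFieldSubfields.

Section GammaBases.

Variables (F : finFieldType) (L : fieldExtType F).

Local Notation V := (finvect_type L).
Local Notation X := (nonzero_vector L).
Local Notation IG := (induced_on_nonzero (Gamma L)).

Implicit Types (x y z : X) (s : seq X) (h : {perm X}).

(** Membership in the group acting on nonzero vectors reduces to a formula on
    underlying field elements; the rest of the proof uses only this
    description. *)
Lemma induced_GammaP h :
  reflect (exists a : V, exists2 sigma : gal_of {:V},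
             a != 0 /\ sigma \in 'Gal({:V} / 1)%g
             & forall x, val (h x) = a * sigma (val x))
          (h \in IG).
Proof.
apply: (iffP morphimP) => [[g gD gG ->]|[a [s [a0 sG] hE]]].
  case/Gamma_setP: (gG) => a [s [a0 sG gE]]; exists a, s => // x.
  by rewrite actpermE val_subact gD /= apermE gE.
have g_inj : injective (fun v : V => a * s v).
  by move=> u v /(mulfI a0) /fmorph_inj.
have gG : perm g_inj \in Gamma L.
  by apply/Gamma_setP; exists a, s; split=> // v; rewrite permE.
exists (perm g_inj) => //.
  exact: (subsetP (linear_group_subact_dom (Gamma L)) _ gG).
apply/permP => x; apply: val_inj; rewrite actpermE val_subact.
by rewrite (subsetP (linear_group_subact_dom _) _ gG) /= apermE permE hE.
Qed.

(** Dividing by x moves the first base point to 1, whose stabilizer is the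
    Galois group itself. *)
Definition ratio_field x s : {subfield V} :=
  <<1 & [seq val y / val x | y <- s]>>%AS.

(** Fixing x forces the multiplier a to be x / sigma x, which leaves sigma as
    the only freedom; fixing y then says that sigma fixes y / x. *)
Lemma pointwise_stabilizer_consP x s h :
  reflect (exists2 sigma : gal_of {:V},
             sigma \in 'Gal({:V} / ratio_field x s)%g
             & forall y, val (h y) = val x * sigma (val y / val x))
          (h \in pointwise_stabilizer IG (x :: s)).
Proof.
have x0 : val x != 0 by exact: (valP x).
rewrite /pointwise_stabilizer inE.
apply: (iffP andP) => [[/induced_GammaP[a [t [a0 tG] hE]] /astabP fix_h]|].
  have tx0 : t (val x) != 0 by rewrite fmorph_eq0.
  have aE : a = val x / t (val x).
    apply: (canRL (mulfK tx0)); rewrite -hE.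
    by have := fix_h x; rewrite !inE eqxx /= apermE => ->.
  have hE' y : val (h y) = val x * t (val y / val x).
    by rewrite hE aE fmorph_div mulrAC -mulrA.
  exists t => //; rewrite -sub1set galois_connection ?subvf //.
  apply/Fadjoin_seqP; split; first exact: sub1v.
  move=> _ /mapP[y ys ->]; apply/fixedFieldP; first exact: memvf.
  move=> _ /set1P->; apply: (mulfI x0); rewrite -hE'.
  have := fix_h y; rewrite !inE ys orbT /= apermE => -> //.
  by rewrite mulrC divfK.
case=> t tG hE; split.
  apply/induced_GammaP; exists (val x / t (val x)), t.
    split; first by rewrite mulf_neq0 ?invr_eq0 ?fmorph_eq0.
    by apply: subsetP tG; rewrite galS ?sub1v.
  by move=> y; rewrite hE fmorph_div mulrA mulrAC.
apply/astabP => y; rewrite !inE => ys; apply: val_inj.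
have yK : val y / val x \in ratio_field x s.
  case/predU1P: ys => [->|ys]; first by rewrite divff // mem1v.
  by apply/seqv_sub_adjoin/map_f.
by rewrite /= apermE hE (fixed_gal (subvf _) tG yK) mulrC divfK.
Qed.

(** The Galois correspondence, in the form that K is the fixed field of
    Gal(L / K), turns a question on stabilizers into one on subfields. *)
Lemma mem_fix_pointwise_stabilizer_cons x s z :
  (z \in 'Fix_('P)(pointwise_stabilizer IG (x :: s))%g) =
  (val z / val x \in ratio_field x s).
Proof.
have x0 : val x != 0 by exact: (valP x).
have <- : fixedField 'Gal({:V} / ratio_field x s)%g = ratio_field x s.
  exact/galois_fixedField/finField_galois/subvf.
apply/afixP/fixedFieldP=> [|fix_z t tG|fix_z h]; first exact: memvf.
  have f_neq0 y : val x * t (val y / val x) != 0.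
    by rewrite mulf_neq0 // fmorph_eq0 mulf_neq0 ?invr_eq0 // (valP y).
  pose f y : X := Sub (val x * t (val y / val x)) (f_neq0 y).
  have f_inj : injective f.
    move=> u v /(congr1 val); rewrite !SubK.
    by move/(mulfI x0)/fmorph_inj/(mulIf (invr_neq0 x0))/val_inj.
  have /fix_z : perm f_inj \in pointwise_stabilizer IG (x :: s).
    by apply/pointwise_stabilizer_consP; exists t => // y; rewrite permE SubK.
  rewrite /= apermE permE => /(congr1 val); rewrite SubK => fz.
  by apply: (mulfI x0); rewrite fz mulrC divfK.
case/pointwise_stabilizer_consP => t tG hE; apply: val_inj.
by rewrite /= apermE hE fix_z // mulrC divfK.
Qed.

(** A permutation group is trivial when it fixes every point, so this follows
    from the description of the fixed points: every nonzero v is the ratio to x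
    of the point v * x. *)
Lemma pointwise_stabilizer_cons_eq1 x s :
  (pointwise_stabilizer IG (x :: s) == 1%g) = (ratio_field x s == {:V}%AS).
Proof.
have x0 : val x != 0 by exact: (valP x).
apply/eqP/eqP=> [st1|full].
  apply/val_inj/eqP; rewrite eqEsubv subvf; apply/subvP => v _.
  have [->|v0] := eqVneq v 0; first exact: mem0v.
  have vx0 : v * val x != 0 by rewrite mulf_neq0.
  rewrite -(mulfK x0 v) -(SubK X vx0) -mem_fix_pointwise_stabilizer_cons st1.
  by apply/afixP => _ /set1P->; rewrite /= apermE perm1.
apply/trivgP/subsetP => h hs; apply/set1P/permP => z; rewrite perm1.
have : z \in 'Fix_('P)(pointwise_stabilizer IG (x :: s))%g.
  by rewrite mem_fix_pointwise_stabilizer_cons full memvf.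
by move/afixP/(_ h hs).
Qed.

Hypothesis dimL_gt1 : (1 < \dim {:L})%N.

(** Multiplication by an element other than 0 and 1 moves every point; a
    generator of L over F is such an element because L is not F. *)
Lemma induced_Gamma_moves x : x \notin 'Fix_('P)(pointwise_stabilizer IG [::])%g.
Proof.
have x0 : val x != 0 by exact: (valP x).
have [a a0 genL] := finField_primitive_element {:V}%AS.
have a1 : a != 1.
  apply: contraTneq dimL_gt1 => a1; rewrite -leqNgt.
  have <- : \dim {:V} = \dim {:L} by [].
  rewrite -genL a1 (Fadjoin_idP _) ?dimv1 //; exact: mem1v.
have ax0 y : a * val y != 0 by rewrite mulf_neq0 // (valP y).
pose f y : X := Sub (a * val y) (ax0 y).
have f_inj : injective f.
  by move=> u v /(congr1 val); rewrite !SubK => /(mulfI a0)/val_inj.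
apply/afixP => /(_ (perm f_inj)) fx; case/negP: a1; apply/eqP.
apply: (mulIf x0); rewrite mul1r -(SubK X (ax0 x)) -/(f x) -(permE f_inj).
rewrite -{2}fx /= ?apermE // inE; apply/andP; split.
  apply/induced_GammaP; exists a, 1%g; rewrite ?group1 // => y.
  by rewrite permE SubK gal_id.
by apply/astabP => y; rewrite !inE.
Qed.

(** Irredundant bases are strictly increasing chains of subfields from F to L:
    each point after the first must have its ratio outside the field generated
    so far.  The first point imposes no condition, since no point is fixed by
    the whole group; for the same reason the empty sequence is not a base. *)
Lemma irredundant_base_GammaP s :
  reflect (exists x, exists2 t, s = x :: t
             & ratio_field x t = {:V}%AS
               /\ forall i, (i < size t)%N ->
                    val (nth x t i) / val x \notin ratio_field x (take i t))
          (irredundant_base IG s).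
Proof.
apply: (iffP andP) => [[]|[x [t -> [full irr]]]].
  case: s => [st1 _|x t].
    have x0 : (1 : V) != 0 by exact: oner_neq0.
    have /afixP[] := induced_Gamma_moves (Sub 1 x0 : X).
    by move=> h; rewrite (eqP st1) => /set1P->; rewrite /= apermE perm1.
  rewrite pointwise_stabilizer_cons_eq1 => /eqP full /forallP irr.
  exists x, t => //; split=> // i i_lt.
  have /= := irr (Ordinal (i_lt : i.+1 < size (x :: t)))%N.
  by rewrite mem_fix_pointwise_stabilizer_cons (tnth_nth x).
split; first by rewrite pointwise_stabilizer_cons_eq1 full.
apply/forallP => -[[|i] i_lt]; rewrite (tnth_nth x) /=.
  exact: induced_Gamma_moves.
by rewrite mem_fix_pointwise_stabilizer_cons irr.
Qed.

(** The degree of an intermediate field divides the degree of L, so when the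
    latter is prime the first ratio outside F already generates L. *)
Lemma irredundant_base_size_prime s :
  prime (\dim {:L}) -> irredundant_base IG s -> size s = 2%N.
Proof.
move=> n_pr /irredundant_base_GammaP[x [t -> [full irr]]].
have dimVL : \dim {:V} = \dim {:L} by [].
case: t full irr => [|y [|z t]] //= full irr.
  have := congr1 (fun E : {subfield V} => \dim E) full.
  by rewrite /= Fadjoin_nil dimv1 dimVL => dL1; have := dimL_gt1; rewrite -dL1.
have := irr 1%N isT; have := irr 0%N isT => /=.
rewrite Fadjoin_nil adjoin_seq1; set c := _ / _ => cN1 /negP[].
suff -> : <<1; c>>%VS = {:V}%VS by exact: memvf.
apply/eqP; rewrite eqEdim subvf /= dimVL.
have /(primeP n_pr).2/orP[/eqP dK1|/eqP->//] : (\dim <<1; c>> %| \dim {:L})%N.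
  by rewrite -dimVL (field_dimS (subvf <<1; c>>%AS)).
case/negP: cN1; apply/Fadjoin_idP => /=.
by apply/eqP; rewrite eq_sym eqEdim sub1v dimv1 /= dK1.
Qed.

(** An intermediate field E refines the chain F < L to F < E < L, which gives
    irredundant bases with two and with three points. *)
Lemma Gamma_not_IBIS : ~~ prime (\dim {:L}) -> ~ IBIS IG.
Proof.
have dimVL : \dim {:V} = \dim {:L} by [].
move=> n_comp ibis.
have [||E /andP[dE_gt1 dE_lt]] := @finField_intermediate F V; rewrite ?dimVL //.
have [a a0 genV] := finField_primitive_element {:V}%AS.
have [b b0 genE] := finField_primitive_element E.
pose x : X := Sub 1 (oner_neq0 V); pose y : X := Sub a a0; pose z : X := Sub b b0.
have aNE : a \notin E.
  apply: contraTN dE_lt => aE; rewrite -leqNgt dimvS // -genV.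
  by apply/FadjoinP; rewrite sub1v.
have not1 (c : V) : (1 < \dim <<1; c>>)%N -> c \notin 1%VS.
  by apply: contraTN => /Fadjoin_idP->; rewrite dimv1.
have b1 : irredundant_base IG [:: x; y].
  apply/irredundant_base_GammaP; exists x, [:: y] => //; split.
    by apply: val_inj; rewrite /= adjoin_seq1 divr1 genV.
  case=> //= _; rewrite Fadjoin_nil.
  by rewrite divr1 not1 // genV dimVL.
have b2 : irredundant_base IG [:: x; z; y].
  apply/irredundant_base_GammaP; exists x, [:: z; y] => //; split.
    apply: val_inj; rewrite /= adjoin_cons adjoin_seq1 !divr1.
    apply/eqP; rewrite eqEsubv subvf /= -genV; apply/FadjoinP.
    by rewrite sub1v memv_adjoin.
  case=> [|[|//]] _ /=.
    rewrite Fadjoin_nil.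
    by rewrite divr1 not1 // genE.
  by rewrite adjoin_seq1 !divr1 genE.
by have := ibis _ _ b1 b2.
Qed.

End GammaBases.

Theorem corollary1p4 (q n : nat) (hq : prime_power q) (hn : (1 < n)%N)
    (F : finFieldType) (hF : #|F| = q)
    (L : fieldExtType F) (hL : \dim {:L} = n) :
  linear_IBIS (Gamma L) <-> prime n.
Proof.
rewrite -hL in hn *; split=> [ibis | n_pr s t bs bt].
  by apply/idPn => /(Gamma_not_IBIS hn).
by rewrite !(irredundant_base_size_prime hn n_pr).
Qed.
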